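(* Let $n\ge 1$ be an integer. Then the polynomial $$\widetilde{A}_n(\mathbf{x},\mathbf{y})=\sum_{\sigma\in A_n}\ \prod_{i\in\widetilde{\mathcal{DT}}_A(\sigma)}x_i\prod_{i\in\widetilde{\mathcal{AT}}_A(\sigma)}y_i\ \in\ \mathbb{R}[x_1,\dots,x_{n+1},y_1,\dots,y_{n+1}]$$ is stable.
   Context: A polynomial $f\in\mathbb{R}[z_1,\dots,z_m]$ is called (real) stable if $f\equiv 0$ or $f(z_1,\dots,z_m)\ne 0$ whenever all $z_j\in\mathbb{C}$ have strictly positive imaginary part. $A_n=\mathrm{Sym}(n+1)$ is the group of all permutations $\sigma=\sigma_1\cdots\sigma_{n+1}$ (one-line notation) of $\{1,\dots,n+1\}$. For $\sigma\in A_n$ let $$\mathcal{DT}_A(\sigma)=\{\max(\sigma_i,\sigma_{i+1}):1\le i\le n,\ \sigma_i>\sigma_{i+1}\},\qquad \mathcal{AT}_A(\sigma)=\{\max(\sigma_i,\sigma_{i+1}):1\le i\le n,\ \sigma_i<\sigma_{i+1}\}.$$ Let $\widetilde{\mathcal{DT}}_A(\sigma)=\mathcal{DT}_A(\sigma)\cup\{\sigma_{n+1}\}$ if $\sigma_{n+1}>\sigma_1$, and $\widetilde{\mathcal{DT}}_A(\sigma)=\mathcal{DT}_A(\sigma)$ otherwise. Let $\widetilde{\mathcal{AT}}_A(\sigma)=\mathcal{AT}_A(\sigma)\cup\{\sigma_1\}$ if $\sigma_{n+1}<\sigma_1$, and $\widetilde{\mathcal{AT}}_A(\sigma)=\mathcal{AT}_A(\sigma)$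 otherwise. *)

(* Defs.v *)
From HB Require Import structures.
From mathcomp Require Import all_boot all_order all_algebra all_fingroup.
From mathcomp Require Import complex mpoly.

Set Implicit Arguments.
Unset Strict Implicit.
Unset Printing Implicit Defensive.

Import Order.TTheory GRing.Theory Num.Theory.

Local Open Scope ring_scope.

Section Stability.
Variables (R : rcfType) (m : nat).

Definition stable (f : {mpoly R[m]}) : Prop :=
  f = 0 \/
  forall z : 'I_m -> R[i],
    (forall j, 0 < complex.Im (z j)) ->
    (map_mpoly (real_complex R) f).@[z] <> 0.

End Stability.

(* Positions and values are 0-based: the element k : 'I_n.+1 stands for
   k + 1 in {1, ..., n + 1}, and s k stands for sigma_(k+1). *)
Section TopSets.
Variables (n : nat) (s : 'S_n.+1).

(* For i : 'I_n, the pair of consecutive positions (i, i + 1) in 'I_n.+1. *)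
Definition lpos (i : 'I_n) : 'I_n.+1 := widen_ord (leqnSn n) i.
Definition rpos (i : 'I_n) : 'I_n.+1 := lift ord0 i.

Definition DT : {set 'I_n.+1} :=
  [set Order.max (s (lpos i)) (s (rpos i)) | i : 'I_n
    & (s (rpos i) < s (lpos i))%N].

Definition AT : {set 'I_n.+1} :=
  [set Order.max (s (lpos i)) (s (rpos i)) | i : 'I_n
    & (s (lpos i) < s (rpos i))%N].

Definition cDT : {set 'I_n.+1} :=
  if (s ord0 < s ord_max)%N then DT :|: [set s ord_max] else DT.

Definition cAT : {set 'I_n.+1} :=
  if (s ord_max < s ord0)%N then AT :|: [set s ord0] else AT.

End TopSets.

Section Eulerian.
Variables (R : rcfType) (n : nat).

(* Of the 2(n + 1) variables, the first n + 1 are the x's, the others the y's. *)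
Definition xvar (i : 'I_n.+1) : {mpoly R[n.+1 + n.+1]} := 'X_(lshift n.+1 i).
Definition yvar (i : 'I_n.+1) : {mpoly R[n.+1 + n.+1]} := 'X_(rshift n.+1 i).

Definition Atilde : {mpoly R[n.+1 + n.+1]} :=
  \sum_(s : 'S_n.+1) (\prod_(i in cDT s) xvar i) * (\prod_(i in cAT s) yvar i).

End Eulerian.

(* Main.v *)
(* Write w(s) for the product over the cyclic edges (s_i, s_(i+1)) of x_a if the
   edge descends from a, of y_b if it ascends to b.  Atilde is the sum C of the
   w(s).  Let L be the same sum over the non-wrapping edges only.  Rotating the
   maximum to the end and deleting it gives
     C_(n+2) = (n+2) x_max y_max L_(n+1),
   while shifting all variables by t and differentiating at t = 0 removes one
   edge, so that, by rotation again,
     d/dt C_(n+2)(x + t, y + t) = (n+2) L_(n+2)(x, y)  at t = 0.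
   If C_(n+2) has no zero on the open upper half plane, then the nonconstant
   polynomial C_(n+2)(x + t, y + t) in t has all its roots strictly below the
   real axis, hence so does its derivative (Gauss-Lucas), and L_(n+2) does not
   vanish either; the claim follows by induction. *)
Require Import Defs.
From mathcomp Require Import all_boot all_order all_algebra reals.
From mathcomp Require Import all_fingroup complex mpoly ring.

Set Implicit Arguments.
Unset Strict Implicit.
Unset Printing Implicit Defensive.

Import Order.TTheory GRing.Theory Num.Theory.

Local Open Scope ring_scope.

(** * Edge weights of cyclic and linear arrangements *)

Section CyclicSums.
Variable A : comNzRingType.

Definition top_weight m (x y : 'I_m -> A) (a b : 'I_m) : A :=
  if (b < a)%N then x a else y b.

(* [i + 1] is taken in the ring 'I_n.+2 = Z/(n+2), hence wraps around. *)
Definition cyclic_sum n (x y : 'I_n.+2 -> A) : A :=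
  \sum_(s : 'S_n.+2) \prod_i top_weight x y (s i) (s (i + 1)).

Definition linear_sum n (x y : 'I_n.+1 -> A) : A :=
  \sum_(s : 'S_n.+1) \prod_(i < n) top_weight x y (s (lpos i)) (s (rpos i)).

Lemma lposD1 n (i : 'I_n.+1) : lpos i + 1 = rpos i.
Proof.
by apply/val_inj; rewrite /= /bump /= addn1 add1n modn_small // ltnS ltn_ord.
Qed.

Lemma ord_maxD1 n : (ord_max : 'I_n.+2) + 1 = ord0.
Proof. by apply/val_inj; rewrite /= addn1 modnn. Qed.

Definition rotation n (k : 'I_n.+2) : 'S_n.+2 := perm (addrI k).

(** Rotating positions by [ord_max - k] turns the deleted edge into the wrapping one; the remaining
    edges form a path. *)
Lemma sum_cyclic_cut n (x y : 'I_n.+2 -> A) (k : 'I_n.+2) :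
  \sum_(s : 'S_n.+2) \prod_(i | i != k) top_weight x y (s i) (s (i + 1)) =
  linear_sum x y.
Proof.
rewrite (reindex_inj (mulgI (rotation (ord_max - k)))) /=.
apply: eq_bigr => s _; under eq_bigr do rewrite !permM !permE addrA.
transitivity (\prod_(i | i != ord_max) top_weight x y (s i) (s (i + 1))).
  rewrite [RHS](reindex_inj (addrI (ord_max - k))) /=.
  by apply: eq_bigl => i; rewrite -(inj_eq (addrI (ord_max - k))) subrK.
rewrite big_mkcond big_ord_recr eqxx /= mulr1.
apply: eq_bigr => i _; rewrite ifT; last first.
  by rewrite -val_eqE /= neq_ltn ltn_ord.
by rewrite -lposD1.
Qed.

Lemma sum_perm_fix_max n (F : 'S_n.+2 -> A) :
  \sum_(s : 'S_n.+2 | s ord_max == ord_max) F s =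
  \sum_(t : 'S_n.+1) F (lift_perm ord_max ord_max t).
Proof.
rewrite (reindex (lift_perm ord_max ord_max)) /=; last first.
  (* Inverse map: delete the last position and its value. The default [k] is never reached, since
     [s] is injective. *)
  pose f (s : 'S_n.+2) k := odflt k (unlift (s ord_max) (s (lift ord_max k))).
  have fK (s : 'S_n.+2) k : lift (s ord_max) (f s k) = s (lift ord_max k).
    rewrite /f; have := neq_lift ord_max k.
    by rewrite -(inj_eq (@perm_inj _ s)) => /unlift_some[] ? ? ->.
  have f_inj s : injective (f s).
    move=> i j /(congr1 (lift (s ord_max))); rewrite !fK.
    by move=> /perm_inj /lift_inj.
  exists (fun s => perm (@f_inj s)) => [s _ | s /eqP s_max]; apply/permP=> k.
    by rewrite permE /f lift_perm_lift lift_perm_id liftK.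
  case: (unliftP ord_max k) => [j|] ->; last by rewrite lift_perm_id.
  by rewrite lift_perm_lift permE -{1}s_max fK.
by apply: eq_bigl => t; rewrite lift_perm_id eqxx.
Qed.

(** Group the permutations by the position of the maximum: rotation makes the [n.+2] classes
    contribute equally. With the maximum last, the edge into it weighs [y ord_max] and the wrapping
    edge out of it [x ord_max]. *)
Lemma cyclic_sumE n (x y : 'I_n.+2 -> A) :
  cyclic_sum x y =
  (x ord_max * y ord_max *
    linear_sum (x \o lift ord_max) (y \o lift ord_max)) *+ n.+2.
Proof.
pose w (s : 'S_n.+2) := \prod_i top_weight x y (s i) (s (i + 1)).
have wR k (s : 'S_n.+2) : w (rotation k * s)%g = w s.
  rewrite /w [RHS](reindex_inj (addrI k)).
  by apply: eq_bigr => i _; rewrite !permM !permE addrA.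
rewrite /cyclic_sum.
rewrite (partition_big (fun s : 'S_n.+2 => s^-1%g ord_max) xpredT) //=.
transitivity (\sum_(j < n.+2) \sum_(s : 'S_n.+2 | s ord_max == ord_max) w s).
  apply: eq_bigr => j _; rewrite (reindex_inj (mulgI (rotation (ord_max - j)))).
  apply: eq_big => [s | s _]; last exact: wR.
  rewrite -(inj_eq (@perm_inj _ (rotation (ord_max - j) * s)%g)) permKV.
  by rewrite permM permE subrK eq_sym.
rewrite sumr_const card_ord sum_perm_fix_max; congr (_ *+ _).
rewrite mulr_sumr; apply: eq_bigr => t _.
have lposE m (j : 'I_m) : lpos j = lift ord_max j.
  by apply/val_inj; rewrite [RHS]lift_max.
(* The [None] case is the edge entering the maximum. *)
have wE (i : 'I_n.+1) : top_weight x y (lift_perm ord_max ord_max t (lpos i))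
    (lift_perm ord_max ord_max t (lpos i + 1)) =
    if unlift ord_max i is Some j then
      top_weight (x \o lift ord_max) (y \o lift ord_max)
        (t (lpos j)) (t (rpos j))
    else y ord_max.
  rewrite lposD1 {1}lposE lift_perm_lift.
  case: unliftP => [j|] ->.
    have -> : rpos (lift ord_max j) = lift ord_max (rpos j).
      by apply/val_inj; rewrite [RHS]lift_max /= {2}/bump leqNgt ltn_ord.
    by rewrite lift_perm_lift /top_weight !lift_max -lposE.
  have -> : rpos ord_max = ord_max :> 'I_n.+2 by apply/val_inj.
  by rewrite lift_perm_id /top_weight lift_max ltnNge ltnW.
rewrite /w big_ord_recr /= ord_maxD1 lift_perm_id; under eq_bigr do rewrite wE.
have -> : ord0 = lift ord_max ord0 :> 'I_n.+2 by apply/val_inj.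
rewrite lift_perm_lift /top_weight lift_max ltn_ord.
rewrite big_ord_recr /= unlift_none.
under eq_bigr => j _ do rewrite -/(lpos j) [in unlift _ _]lposE liftK.
by rewrite [RHS]mulrC mulrA mulrAC -mulrA.
Qed.

End CyclicSums.

(** * Cyclic descent and ascent tops as edge weights *)

Section CyclicWeight.
Variables (A : comNzRingType) (n : nat) (x y : 'I_n.+2 -> A) (s : 'S_n.+2).

(** The extra element of [cDT] is the top of the wrapping edge, present exactly when that edge
    descends; a descent has its top at its start. *)
Lemma cDTE : cDT s = [set s i | i : 'I_n.+2 & (s (i + 1)%R < s i)%N].
Proof.
apply/setP => v; apply/idP/imsetP => [ | [i ]]; rewrite /cDT.
  have DTP : v \in DT s ->
      exists2 i, i \in [set i | (s (i + 1)%R < s i)%N] & v = s i.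
    case/imsetP=> i; rewrite inE => lt_i ->.
    exists (lpos i); first by rewrite inE lposD1.
    by rewrite max_l // leEord ltnW.
  case: ifP => // lt0; rewrite inE => /orP[// | ]; rewrite inE => /eqP->.
  by exists ord_max; rewrite // inE ord_maxD1.
rewrite inE => lt_i ->; case: (unliftP ord_max i) lt_i => [j|] ->.
  have -> : lift ord_max j = lpos j by apply/val_inj; exact: lift_max.
  rewrite lposD1 => lt_j; have sj : s (lpos j) \in DT s.
    by apply/imsetP; exists j; rewrite ?inE // max_l // leEord ltnW.
  by case: ifP => // _; rewrite inE sj.
by rewrite ord_maxD1 => lt_i; rewrite lt_i !inE eqxx orbT.
Qed.

Lemma cATE : cAT s = [set s (i + 1) | i : 'I_n.+2 & (s i < s (i + 1)%R)%N].
Proof.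
apply/setP => v; apply/idP/imsetP => [ | [i ]]; rewrite /cAT.
  have ATP : v \in AT s ->
      exists2 i, i \in [set i | (s i < s (i + 1)%R)%N] & v = s (i + 1).
    case/imsetP=> i; rewrite inE => lt_i ->.
    exists (lpos i); first by rewrite inE lposD1.
    by rewrite lposD1 max_r // leEord ltnW.
  case: ifP => // lt0; rewrite inE => /orP[// | ]; rewrite inE => /eqP->.
  by exists ord_max; rewrite ?inE ord_maxD1.
rewrite inE => lt_i ->; case: (unliftP ord_max i) lt_i => [j|] ->.
  have -> : lift ord_max j = lpos j by apply/val_inj; exact: lift_max.
  rewrite lposD1 => lt_j; have sj : s (rpos j) \in AT s.
    by apply/imsetP; exists j; rewrite ?inE // max_r // leEord ltnW.
  by case: ifP => // _; rewrite inE sj.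
by rewrite ord_maxD1 => lt_i; rewrite lt_i !inE eqxx orbT.
Qed.

Lemma prod_cDT_cAT :
  (\prod_(i in cDT s) x i) * (\prod_(i in cAT s) y i) =
  \prod_i top_weight x y (s i) (s (i + 1)).
Proof.
rewrite cDTE cATE !big_imset /=; last 2 first.
- by move=> i j _ _ /perm_inj/addIr.
- by move=> i j _ _ /perm_inj.
rewrite [X in X * _]big_mkcond [X in _ * X]big_mkcond -big_split /=.
apply: eq_bigr => i _; rewrite !inE /top_weight.
(* Equal ends would force [i + 1 = i], that is, [1 = 0] modulo [n.+2]. *)
case: ltngtP => [||/val_inj/perm_inj/eqP]; rewrite ?mulr1 ?mul1r //.
by rewrite -subr_eq0 addrC addKr oner_eq0.
Qed.

End CyclicWeight.

(** * The diagonal shift and its derivative *)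

Lemma deriv_prod (A : comNzRingType) (I : eqType) (r : seq I)
    (F : I -> {poly A}) :
  uniq r ->
  (\prod_(i <- r) F i)^`() =
  \sum_(i <- r) (F i)^`() * \prod_(j <- r | j != i) F j.
Proof.
elim: r => [|a r IH] /=; first by rewrite !big_nil derivC.
case/andP=> a_r /IH {}IH; rewrite !big_cons derivM eqxx /= IH mulr_sumr.
congr (_ * _ + _).
  rewrite [RHS]big_seq_cond [LHS]big_seq; apply: eq_bigl => j.
  by case: eqVneq => [->|]; rewrite ?andbT // (negPf a_r).
rewrite [LHS]big_seq [RHS]big_seq; apply: eq_bigr => i i_r; rewrite big_cons.
by case: eqVneq i_r => [<-|_ _]; rewrite ?(negPf a_r) // mulrCA.
Qed.

Lemma deriv_cyclic_sum (A : comNzRingType) n (x y : 'I_n.+2 -> A) :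
  (cyclic_sum (fun i => 'X + (x i)%:P) (fun i => 'X + (y i)%:P))^`().[0] =
  linear_sum x y *+ n.+2.
Proof.
rewrite /cyclic_sum raddf_sum horner_sum /=.
have dE (s : 'S_n.+2) : (\prod_i top_weight (fun i => 'X + (x i)%:P)
    (fun i => 'X + (y i)%:P) (s i) (s (i + 1)))^`().[0] =
    \sum_k \prod_(i | i != k) top_weight x y (s i) (s (i + 1)).
  rewrite deriv_prod ?index_enum_uniq // horner_sum; apply: eq_bigr => k _.
  rewrite hornerM horner_prod /top_weight.
  have -> : (if (s (k + 1)%R < s k)%N then 'X + (x (s k))%:P
             else 'X + (y (s (k + 1)))%:P)^`() = 1.
    by case: ifP => _; rewrite derivD derivX derivC addr0.
  rewrite hornerC mul1r; apply: eq_bigr => i _.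
  by case: ifP => _; rewrite hornerD hornerX hornerC add0r.
under eq_bigr do rewrite dE.
rewrite exchange_big /=; under eq_bigr do rewrite sum_cyclic_cut.
by rewrite sumr_const card_ord.
Qed.

Lemma horner_cyclic_sum (A : comNzRingType) n (x y : 'I_n.+2 -> A) (z : A) :
  (cyclic_sum (fun i => 'X + (x i)%:P) (fun i => 'X + (y i)%:P)).[z] =
  cyclic_sum (fun i => z + x i) (fun i => z + y i).
Proof.
rewrite /cyclic_sum horner_sum; apply: eq_bigr => s _; rewrite horner_prod.
apply: eq_bigr => i _; rewrite /top_weight.
by case: ifP => _; rewrite hornerD hornerX hornerC.
Qed.

(** Each summand is monic of degree [n.+2], so the coefficient in that degree is [(n.+2)!], nonzero
    in characteristic zero. *)
Lemma cyclic_sum_size_gt1 (A : numDomainType) n (x y : 'I_n.+2 -> A) :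
  (1 < size (cyclic_sum (fun i => 'X + (x i)%:P) (fun i => 'X + (y i)%:P))%R)%N.
Proof.
rewrite ltnNge; apply/negP => /leq_sizeP /(_ n.+2 isT) /eqP.
rewrite /cyclic_sum coef_sum (eq_bigr (fun=> 1)) => [|s _]; last first.
  pose F i := top_weight (fun j => 'X + (x j)%:P) (fun j => 'X + (y j)%:P)
    (s i) (s (i + 1)).
  have F_monic i : F i \is monic.
    by rewrite /F /top_weight; case: ifP => _; exact: monicXaddC.
  have size_F i : size (F i) = 2.
    by rewrite /F /top_weight; case: ifP => _; rewrite size_XaddC.
  have /monicP : \prod_i F i \is monic by apply: monic_prod.
  rewrite /lead_coef size_prod => [|i _]; last exact: monic_neq0.
  rewrite (eq_bigr (fun=> 2%N)) => [|i _]; last exact: size_F.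
  by rewrite sum_nat_const card_ord muln2 -addnn -addSn addnK.
by rewrite sumr_const pnatr_eq0 card_Sn gtn_eqF ?fact_gt0.
Qed.

(** * Zeros and the upper half plane *)

Section UpperHalfPlane.
Variable R : rcfType.
Implicit Types (z : R[i]) (p : {poly R[i]}).

Lemma ImD (z w : R[i]) : complex.Im (z + w) = complex.Im z + complex.Im w.
Proof. by case: z w => [a b] [c d]. Qed.

(* The imaginary part of the logarithmic derivative [p' / p] at [0] is a sum of
   the [Im (- 1 / r)], all of which are negative. *)
Lemma deriv0_neq0 p :
  (1 < size p)%N -> (forall z, 0 <= complex.Im z -> p.[z] != 0) ->
  p^`().[0] != 0.
Proof.
move=> p_gt1 p_neq0; have [r pE] := closed_field_poly_normal p.
have lc_neq0 : lead_coef p != 0.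
  by rewrite lead_coef_eq0 -size_poly_eq0 -lt0n ltnW.
have r_lt0 a : a \in r -> complex.Im a < 0.
  move=> a_r; rewrite ltNge; apply/negP => /p_neq0/negP; apply.
  by rewrite -/(root p a) pE rootZ // root_prod_XsubC.
have r_neq0 : (0 < size r)%N.
  by move: p_gt1; rewrite pE size_scale // size_prod_XsubC.
have {p_neq0} P0 : p.[0] != 0 by exact: p_neq0.
have lt_Im : complex.Im (p^`().[0] / p.[0]) < 0.
  have -> : p^`().[0] / p.[0] = - \sum_(a <- r) a^-1.
    rewrite pE derivZ !hornerZ invfM mulrACA divff // mul1r.
    elim: (r) r_lt0 => [|a s IH] r_lt0.
      by rewrite !big_nil derivC horner0 mul0r oppr0.
    have a0 : a != 0.
      by apply/eqP => a0; have := r_lt0 a (mem_head _ _); rewrite a0 ltxx.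
    have {}IH := IH (fun b bs => r_lt0 b (@mem_behead _ (a :: s) _ bs)).
    have q0 : (\prod_(b <- s) ('X - b%:P)).[0] != 0.
      rewrite -/(root _ _) root_prod_XsubC; apply/negP => zs.
      by have := r_lt0 0 (@mem_behead _ (a :: s) _ zs); rewrite ltxx.
    rewrite !big_cons derivM derivXsubC mul1r !hornerE /= opprD -IH.
    by field; rewrite q0.
  elim: (r) r_lt0 r_neq0 => [//|a s IH] r_lt0 _.
  have a_lt0 := r_lt0 a (mem_head _ _).
  (* This imaginary part is that of [a] divided by the squared modulus of [a]. *)
  have Va : complex.Im (- a^-1) < 0.
    case: a a_lt0 {r_lt0} => a b /= b_lt0; rewrite opprK pmulr_llt0 // invr_gt0.
    by rewrite ltr_wpDl ?sqr_ge0 // exprn_even_gt0 //= lt_eqF.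
  rewrite big_cons opprD ImD; case: s IH r_lt0 => [|b s] IH r_lt0.
    by rewrite big_nil oppr0 addr0.
  rewrite -[ltRHS]addr0 ltrD // IH // => c cs.
  by apply: r_lt0; rewrite in_cons cs orbT.
by apply: contraTneq lt_Im => ->; rewrite mul0r ltxx.
Qed.

Lemma linear_sum_neq0 n (x y : 'I_n.+1 -> R[i]) :
  (forall i, 0 < complex.Im (x i)) -> (forall i, 0 < complex.Im (y i)) ->
  linear_sum x y != 0.
Proof.
have H_neq0 (z : R[i]) : 0 < complex.Im z -> z != 0.
  by apply: contraTneq => ->; rewrite ltxx.
elim: n x y => [|n IH] x y x_gt0 y_gt0.
  rewrite /linear_sum; under eq_bigr do rewrite big_ord0.
  by rewrite sumr_const pnatr_eq0 card_Sn.
have := deriv0_neq0 (cyclic_sum_size_gt1 x y).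
rewrite deriv_cyclic_sum mulrn_eq0 /=; apply=> z z_ge0.
(* A shift by [z] with nonnegative imaginary part keeps all variables in the open upper half plane,
   so the induction hypothesis applies once the maximum is deleted. *)
rewrite horner_cyclic_sum cyclic_sumE mulrn_eq0 /= !mulf_neq0 //.
- by rewrite H_neq0 // ImD ltr_wpDl.
- by rewrite H_neq0 // ImD ltr_wpDl.
- by apply: IH => i; rewrite ImD ltr_wpDl.
Qed.

End UpperHalfPlane.

Theorem theorem4p1 (R : realType) (n : nat) (hn : (1 <= n)%N) :
  stable (Atilde R n).
Proof.
case: n hn => // n _; right=> z z_gt0; apply/eqP.
pose x i := z (lshift n.+2 i); pose y i := z (rshift n.+2 i).
have -> : (map_mpoly (real_complex R) (Atilde R n.+1)).@[z] = cyclic_sum x y.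
  rewrite /Atilde (rmorph_sum (map_mpoly _)) (rmorph_sum (meval z)).
  apply: eq_bigr => s _; rewrite -prod_cDT_cAT.
  rewrite (rmorphM (map_mpoly _)) (rmorphM (meval z)).
  rewrite !(rmorph_prod (map_mpoly _)) !(rmorph_prod (meval z)).
  by congr (_ * _); apply: eq_bigr => i _; rewrite /= map_mpolyX mevalXU.
have z_neq0 j : z j != 0.
  by apply: contraTneq (z_gt0 j) => ->; rewrite ltxx.
rewrite cyclic_sumE mulrn_eq0 /= !mulf_neq0 ?z_neq0 //.
by apply: linear_sum_neq0 => i; exact: z_gt0.
Qed.
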